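(* Let $X$ be a real Banach space and let $f_1,\dots,f_n \in Lip_0(X)$ be linearly independent. For each $i$ let $\hat f_i : F(X)\to\mathbb{R}$ be the bounded linear functional with $\hat f_i(\delta_x)=f_i(x)$ for all $x\in X$. Then the quotient Banach space $Lip_0(X)/\operatorname{span}\{f_1,\dots,f_n\}$ is linearly isometrically isomorphic to the dual space $\left(\bigcap_{i=1}^{n}\ker(\hat f_i)\right)^{*}$, where $\bigcap_{i=1}^n \ker(\hat f_i)$ is regarded as a closed subspace of $F(X)$.
   Context: $Lip_0(X)$ is the Banach space of all Lipschitz functions $f:X\to\mathbb{R}$ with $f(0)=0$, with norm $Lip(f)=\sup_{x\neq y}\frac{|f(x)-f(y)|}{\|x-y\|}$. For $x\in X$, $\delta_x\in Lip_0(X)^*$ is the evaluation functional $\delta_x(f)=f(x)$. The Lipschitz-free space is $F(X)=\overline{\operatorname{span}}^{\|\cdot\|}\{\delta_x : x\in X\}\subset Lip_0(X)^*$. It is a standard fact that every $f\in Lip_0(X)$ induces a unique bounded linear functional $\hat f$ on $F(X)$ with $\hat f(\delta_x)=f(x)$ for all $x$, and that $f\mapsto\hat f$ is a linear isometric isomorphism of $Lip_0(X)$ onto $F(X)^*$. *)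

(* Defs.v *)
From HB Require Import structures.
From mathcomp Require Import all_boot all_order all_algebra.
From mathcomp Require Import all_classical all_reals all_analysis.

Set Implicit Arguments.
Unset Strict Implicit.
Unset Printing Implicit Defensive.

Import Order.TTheory GRing.Theory Num.Theory.
Import numFieldNormedType.Exports.

Local Open Scope classical_set_scope.
Local Open Scope ring_scope.
Local Open Scope quotient_scope.

Section Subspaces.
Variables (R : realType) (V : normedModType R).
Implicit Types (A W : set V) (a : R) (u v w : V).

Definition is_subspace W :=
  W 0 /\ forall a u v, W u -> W v -> W (a *: u + v).

Definition lin_span A : set V := smallest is_subspace A.

Definition linearly_independent n (f : 'I_n -> V) :=
  forall c : 'I_n -> R, \sum_(i < n) c i *: f i = 0 -> forall i, c i = 0.

Lemma lin_span_subspace A : is_subspace (lin_span A).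
Proof.
split=> [W [[W0 _] _]//|a u v Au Av W WA].
by have [[_ WD] _] := WA; apply: WD; [exact: Au|exact: Av].
Qed.

Lemma sub_lin_span A : A `<=` lin_span A.
Proof. exact: sub_smallest. Qed.

Lemma subspaceD W u v : is_subspace W -> W u -> W v -> W (u + v).
Proof. by move=> [_ WD] Wu Wv; rewrite -[u]scale1r; exact: WD. Qed.

Lemma subspaceZ W a u : is_subspace W -> W u -> W (a *: u).
Proof. by move=> [W0 WD] Wu; rewrite -[_ *: _]addr0; exact: WD. Qed.

Lemma subspaceN W u : is_subspace W -> W u -> W (- u).
Proof. by move=> sW Wu; rewrite -scaleN1r; exact: subspaceZ. Qed.

Lemma subspaceB W u v : is_subspace W -> W u -> W v -> W (u - v).
Proof. by move=> sW Wu /(subspaceN sW); exact: subspaceD. Qed.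

Lemma subspace_sum W n (c : 'I_n -> R) (f : 'I_n -> V) :
  is_subspace W -> (forall i, W (f i)) -> W (\sum_(i < n) c i *: f i).
Proof.
move=> sW Wf; apply: big_ind => [|u v|i _]; first by case: sW.
- exact: subspaceD.
- exact: subspaceZ.
Qed.

Lemma lin_span_range n (f : 'I_n -> V) :
  lin_span (range f) = [set v | exists c : 'I_n -> R, v = \sum_(i < n) c i *: f i].
Proof.
apply/seteqP; split=> [v|v [c ->]]; last first.
  apply: subspace_sum; first exact: lin_span_subspace.
  by move=> i; apply: sub_lin_span; exists i.
apply; split; first split.
- by exists (fun=> 0); rewrite big1// => i _; rewrite scale0r.
- move=> a _ _ [c ->] [d ->]; exists (fun i => a * c i + d i).
  rewrite scaler_sumr -big_split; apply: eq_bigr => i _ /=.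
  by rewrite scalerDl scalerA.
- move=> _ [i _ <-]; exists (fun j => (j == i)%:R).
  rewrite (bigD1 i)//= eqxx scale1r big1 ?addr0// => j /negPf ->.
  by rewrite scale0r.
Qed.

Lemma closure_normP A v :
  closure A v <-> forall e, 0 < e -> exists2 w, A w & `|v - w| < e.
Proof.
split=> [clA e e0|H B /nbhs_normP[e /= e0 eB]].
  by have [w [Aw]] := clA _ (nbhsx_ballx v e e0); rewrite -ball_normE; exists w.
by have [w Aw vw] := H _ e0; exists w; split => //; apply: eB.
Qed.

Lemma closed_normP A :
  closed A <-> forall v, (forall e, 0 < e -> exists2 w, A w & `|v - w| < e) -> A v.
Proof.
split=> [cA v /closure_normP/cA//|H v /closure_normP]; exact: H.
Qed.

Lemma closure_subspace W : is_subspace W -> is_subspace (closure W).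
Proof.
move=> sW; split=> [|a u v]; first by apply: subset_closure; case: sW.
move=> /closure_normP Wu /closure_normP Wv; apply/closure_normP => e e0.
have a0 : 0 < `|a| + 1 by rewrite ltr_wpDl.
have [u' Wu' uu'] := Wu (e / 2 / (`|a| + 1)) ltac:(by rewrite !divr_gt0).
have [v' Wv' vv'] := Wv (e / 2) ltac:(by rewrite divr_gt0).
exists (a *: u' + v'); first by case: sW => _; exact.
rewrite opprD addrACA -scalerBr (le_lt_trans (ler_normD _ _))//.
rewrite [e]splitr ler_ltD// normrZ (@le_trans _ _ ((`|a| + 1) * `|u - u'|))//.
  by rewrite ler_wpM2r// lerDl.
by rewrite mulrC -ler_pdivlMr// ltW.
Qed.

(* A closed subspace stays closed after adding one direction: the coefficients
   along [v] of the approximations of a limit point are squeezed by the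
   distance [e] of [v] to [W]. *)
Lemma closed_add_line W v : is_subspace W -> closed W ->
  closed [set x | exists a w, W w /\ x = w + a *: v].
Proof.
move=> sW cW; have [Wv|nWv] := pselect (W v).
  rewrite [X in closed X](_ : _ = W)//.
  apply/seteqP; split=> [_ [a [w [Ww ->]]]|w Ww].
    by apply: subspaceD => //; exact: subspaceZ.
  by exists 0, w; rewrite scale0r addr0.
have [e e0 We] : exists2 e, 0 < e & forall w, W w -> e <= `|v - w|.
  apply: contrapT => /forall2NP H; apply: nWv.
  move/closed_normP: cW; apply => e e0.
  have [//|/existsNP[w /not_implyP[Ww /negP]]] := H e.
  by rewrite -ltNge; exists w.
have eW a w : W w -> `|a| * e <= `|w + a *: v|.
  move=> Ww; have [->|a0] := eqVneq a 0; first by rewrite normr0 mul0r.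
  have -> : w + a *: v = a *: (v - (- a^-1) *: w).
    by rewrite scalerBr scalerA mulrN mulfV// scaleN1r opprK addrC.
  by rewrite normrZ ler_wpM2l// We//; exact: subspaceZ.
apply/closed_normP => u Hu.
pose S := [set s | exists d a w, [/\ 0 < d, W w, `|u - (w + a *: v)| < d &
  s = a - d / e]].
have key d a w d' a' w' : W w -> W w' -> `|u - (w + a *: v)| < d ->
    `|u - (w' + a' *: v)| < d' -> a - d / e <= a' + d' / e.
  move=> Ww Ww' Hd Hd'.
  rewrite lerBlDr -addrA -mulrDl -lerBlDl ler_pdivlMr//.
  rewrite (le_trans (ler_wpM2r (ltW e0) (ler_norm _)))//.
  rewrite (le_trans (eW (a - a') (w - w') (subspaceB sW Ww Ww')))//.
  have -> : w - w' + (a - a') *: v =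
      (u - (w' + a' *: v)) - (u - (w + a *: v)).
    by rewrite opprB [RHS]addrC addrA subrK scalerBl opprD addrACA.
  by rewrite (le_trans (ler_normB _ _))// lerD// ltW.
have [d0 [a0 [w0 [W0 Hd0]]]] : exists d0 a0 w0, W w0 /\ `|u - (w0 + a0 *: v)| < d0.
  have [_ [a [w [Ww ->]]] uw] := Hu 1 ltr01.
  by exists 1, a, w.
have supS : has_sup S.
  split; last first.
    exists (a0 + d0 / e) => _ [d [a [w [d_gt0 Ww Hd ->]]]].
    exact: key Ww W0 Hd Hd0.
  exists (a0 - d0 / e), d0, a0, w0; split => //.
  by rewrite (le_lt_trans _ Hd0).
pose b := sup S.
exists b, (u - b *: v); split; last by rewrite subrK.
have bP d a w : 0 < d -> W w -> `|u - (w + a *: v)| < d -> `|b - a| <= d / e.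
  move=> d_gt0 Ww Hd; rewrite ler_distl; apply/andP; split.
    by apply: sup_upper_bound => //; exists d, a, w.
  apply: ge_sup; first by case: supS.
  move=> _ [d' [a' [w' [_ Ww' Hd' ->]]]].
  exact: key Ww' Ww Hd' Hd.
move/closed_normP: cW; apply => d d_gt0.
pose k := 1 + `|v| / e.
have k0 : 0 < k by rewrite ltr_wpDr// divr_ge0// ltW.
have [_ [a [w [Ww ->]]] uw] := Hu (d / k) ltac:(by rewrite divr_gt0).
exists w => //.
have -> : u - b *: v - w = (u - (w + a *: v)) - (b - a) *: v.
  by rewrite scalerBl opprB opprD !addrA subrK addrAC.
rewrite (le_lt_trans (ler_normB _ _))//.
have -> : d = d / k + (d / k / e) * `|v|.
  by rewrite mulrAC -mulrA -[X in X + _]mulr1 -mulrDr divfK// gt_eqF.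
rewrite ltr_leD// normrZ ler_wpM2r//.
by apply: bP Ww uw; rewrite divr_gt0.
Qed.

Lemma closed_lin_span_range n (f : 'I_n -> V) : closed (lin_span (range f)).
Proof.
elim: n f => [|n IH] f.
  apply/closed_normP => v Hv; have [<-|v0] := eqVneq 0 v.
    by case: (lin_span_subspace (range f)).
  have [w + vw] := Hv `|v| ltac:(by rewrite normr_gt0 eq_sym).
  rewrite lin_span_range => -[c]; rewrite big_ord0 => w0.
  by move: vw; rewrite w0 subr0 ltxx.
have := @closed_add_line _ (f ord_max)
  (lin_span_subspace (range (f \o widen_ord (leqnSn n)))) (IH _).
congr closed; rewrite !lin_span_range; apply/seteqP; split.
  move=> _ [a [_ [[c ->] ->]]].
  exists (fun i => if unlift ord_max i is Some j then c j else a).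
  rewrite big_ord_recr/= unlift_none; congr (_ + _).
  apply: eq_bigr => i _; congr (_ *: _).
  have -> : widen_ord (leqnSn n) i = lift ord_max i.
    by apply/val_inj; rewrite /= /bump leqNgt ltn_ord.
  by rewrite liftK.
move=> _ [c ->]; rewrite big_ord_recr/=.
pose w := widen_ord (leqnSn n).
exists (c ord_max), (\sum_(i < n) c (w i) *: f (w i)).
by split => //; exists (c \o w).
Qed.

End Subspaces.

Definition isometrically_isomorphic (R : realType) (U V : normedModType R) :=
  exists T : {linear U -> V}, (forall u, `|T u| = `|u|) /\ bijective T.

Section ClosedSubspace.
Variables (R : realType) (V : normedModType R).

Record closed_subspace := ClosedSubspace {
  csub_set :> set V;
  csub_subspace : is_subspace csub_set;
  csub_closed : closed csub_set }.

Definition csub_pred (W : closed_subspace) : {pred V} :=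
  fun v => v \in (W : set V).

Lemma csub_predE (W : closed_subspace) v : (v \in csub_pred W) <-> csub_set W v.
Proof. by rewrite unfold_in; split=> [/set_mem|/mem_set]. Qed.

Lemma csub_submod_closed W : submod_closed (csub_pred W).
Proof.
have [W0 WD] := csub_subspace W.
split=> [|a u v]; first exact/csub_predE.
by move=> /csub_predE Wu /csub_predE Wv; apply/csub_predE; exact: WD.
Qed.

HB.instance Definition _ W :=
  GRing.isSubmodClosed.Build R V (csub_pred W) (csub_submod_closed W).

Record csub_space (W : closed_subspace) := CsubElem {
  csub_val :> V;
  csub_valP : csub_val \in csub_pred W }.

HB.instance Definition _ W := [isSub for @csub_val W].
HB.instance Definition _ W := [Choice of csub_space W by <:].
HB.instance Definition _ W := [SubChoice_isSubLmodule of csub_space W by <:].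

Section Norm.
Variable W : closed_subspace.
Implicit Types u v : csub_space W.

Let norm u : R := `|(u : V)|.

Let normD u v : norm (u + v) <= norm u + norm v.
Proof. exact: ler_normD. Qed.

Let normZ a u : norm (a *: u) = `|a| * norm u.
Proof. exact: normrZ. Qed.

Let norm0_eq0 u : norm u = 0 -> u = 0.
Proof. by move=> /normr0_eq0 u0; exact: val_inj. Qed.

HB.instance Definition _ :=
  Lmodule_isNormed.Build R (csub_space W) normD normZ norm0_eq0.

End Norm.

Lemma csub_normE W (u : csub_space W) : `|u| = `|(u : V)|.
Proof. by []. Qed.

Definition quotient_space (W : closed_subspace) := Quotient.quot (csub_pred W).

Section Quotient.
Variable W : closed_subspace.
Notation Q := (quotient_space W).
Implicit Types (a b : R) (p q : Q) (u v : V).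

HB.instance Definition _ := GRing.Zmodule.on Q.
HB.instance Definition _ := EqQuotient.on Q.

Lemma quotient_eqP u v : \pi_Q u = \pi_Q v <-> csub_set W (u - v).
Proof.
split=> [/eqP|Wuv]; first by rewrite -Quotient.idealrBE => /csub_predE.
by apply/eqP; rewrite -Quotient.idealrBE; exact/csub_predE.
Qed.

Lemma quotient_piD u v : \pi_Q (u + v) = \pi_Q u + \pi_Q v.
Proof. by rewrite piE. Qed.

Definition quotient_scale a q : Q := \pi_Q (a *: repr q).

Let piZ a u : \pi_Q (a *: u) = quotient_scale a (\pi_Q u).
Proof.
apply/quotient_eqP; rewrite -scalerBr; apply: subspaceZ.
  exact: csub_subspace.
by apply/quotient_eqP; rewrite reprK.
Qed.

Let scaleA a b q :
  quotient_scale a (quotient_scale b q) = quotient_scale (a * b) q.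
Proof.
by rewrite -[q]reprK -(piZ b) -(piZ a) -(piZ (a * b)) scalerA.
Qed.

Let scale1 : left_id 1 quotient_scale.
Proof. by move=> q; rewrite -[q]reprK -!piZ scale1r. Qed.

Let scaleDr : right_distributive quotient_scale +%R.
Proof.
move=> a p q; rewrite -[p]reprK -[q]reprK -quotient_piD -!piZ -quotient_piD.
by rewrite scalerDr.
Qed.

Let scaleDl q : {morph quotient_scale^~ q : a b / a + b}.
Proof.
by move=> a b /=; rewrite -[q]reprK -!piZ -quotient_piD scalerDl.
Qed.

HB.instance Definition _ :=
  GRing.Zmodule_isLmodule.Build R Q scaleA scale1 scaleDr scaleDl.

Lemma quotient_piZ a u : \pi_Q (a *: u) = a *: \pi_Q u.
Proof. exact: piZ. Qed.

Definition quotient_norm q : R := inf [set `|v| | v in [set v | \pi_Q v = q]].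

Lemma quotient_norm_has_inf q :
  has_inf [set `|v| | v in [set v | \pi_Q v = q]].
Proof.
split; last by exists 0 => _ [v _ <-].
by exists `|repr q|, (repr q) => //=; rewrite reprK.
Qed.

Lemma quotient_norm_le v : quotient_norm (\pi_Q v) <= `|v|.
Proof. by apply: ge_inf; [case: (quotient_norm_has_inf (\pi_Q v))|exists v]. Qed.

Lemma quotient_norm_lt q e : 0 < e ->
  exists2 v, \pi_Q v = q & `|v| < quotient_norm q + e.
Proof.
move=> e0; have [_ [v vq <-] ve] := inf_adherent e0 (quotient_norm_has_inf q).
by exists v.
Qed.

Lemma quotient_norm_ge0 q : 0 <= quotient_norm q.
Proof.
apply: lb_le_inf; first by case: (quotient_norm_has_inf q).
by move=> _ [v _ <-].
Qed.

Let normD p q : quotient_norm (p + q) <= quotient_norm p + quotient_norm q.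
Proof.
apply/ler_addgt0Pr => e e0.
have [u <- ue] := quotient_norm_lt p (divr_gt0 e0 (ltr0Sn R 1)).
have [v <- ve] := quotient_norm_lt q (divr_gt0 e0 (ltr0Sn R 1)).
rewrite -quotient_piD (le_trans (quotient_norm_le _))//.
rewrite (le_trans (ler_normD _ _))// [e]splitr addrACA.
by rewrite lerD// ltW.
Qed.

Let normZ_le a q : quotient_norm (a *: q) <= `|a| * quotient_norm q.
Proof.
apply/ler_addgt0Pr => e e0; have a0 : 0 < `|a| + 1 by rewrite ltr_wpDl.
have [u uq ue] := quotient_norm_lt q (divr_gt0 e0 a0).
rewrite -uq -quotient_piZ (le_trans (quotient_norm_le _))// normrZ uq.
rewrite (le_trans (ler_wpM2l (normr_ge0 a) (ltW ue)))// mulrDr lerD2l.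
by rewrite mulrCA ger_pMr// ler_pdivrMr// mul1r lerDl.
Qed.

Let normZ a q : quotient_norm (a *: q) = `|a| * quotient_norm q.
Proof.
have [->|a0] := eqVneq a 0.
  rewrite scale0r normr0 mul0r; apply/eqP; rewrite eq_le quotient_norm_ge0.
  by have := normZ_le 0 q; rewrite scale0r normr0 mul0r => ->.
apply/eqP; rewrite eq_le normZ_le/=.
have := normZ_le a^-1 (a *: q); rewrite scalerA mulVf// scale1r normfV.
by rewrite ler_pdivlMl// normr_gt0.
Qed.

Let norm0_eq0 q : quotient_norm q = 0 -> q = 0.
Proof.
move=> q0; have <- : \pi_Q 0 = 0 :> Q by rewrite piE.
rewrite -[q]reprK; apply/quotient_eqP; rewrite subr0.
move/closed_normP: (csub_closed (c := W)); apply => e e0.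
have [v vq] := quotient_norm_lt q e0; rewrite q0 add0r => ve.
exists (repr q - v); last by rewrite opprB addrC subrK.
by apply/quotient_eqP; rewrite reprK.
Qed.

HB.instance Definition _ :=
  Lmodule_isNormed.Build R Q normD normZ norm0_eq0.

Lemma quotient_normE q :
  `|q| = inf [set `|v| | v in [set v | \pi_Q v = q]].
Proof. by []. Qed.

End Quotient.

End ClosedSubspace.

Section Dual.
Variables (R : realType) (V : normedModType R).

Definition dual_pred : {pred V -> R} :=
  fun phi => `[< linear phi /\ exists M, forall v, `|phi v| <= M * `|v| >].

Record dual := Dual { dual_fun :> V -> R; dual_funP : dual_fun \in dual_pred }.

HB.instance Definition _ := [isSub for dual_fun].
HB.instance Definition _ := [Choice of dual by <:].

Lemma dual_submod_closed : submod_closed dual_pred.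
Proof.
split=> [|a phi psi].
  apply/asboolP; split=> [b u v|]; first by rewrite /= scaler0 addr0.
  by exists 0 => v; rewrite normr0 mul0r.
move=> /asboolP[lphi [M HM]] /asboolP[lpsi [N HN]]; apply/asboolP.
split=> [b u v|].
  rewrite !fctE lphi lpsi scalerDr addrACA scalerDr; congr (_ + _ + _).
  by rewrite scalerA mulrC -scalerA.
exists (`|a| * M + N) => v; rewrite !fctE (le_trans (ler_normD _ _))//.
by rewrite mulrDl lerD// normrM -mulrA ler_wpM2l.
Qed.

HB.instance Definition _ :=
  GRing.isSubmodClosed.Build R (V -> R) dual_pred dual_submod_closed.
HB.instance Definition _ := [SubChoice_isSubLmodule of dual by <:].

Implicit Types (phi psi : dual) (a M : R).

Lemma dual_linear phi : linear phi.
Proof. by have /asboolP[] := dual_funP phi. Qed.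

HB.instance Definition _ phi :=
  GRing.isLinear.Build R V R *:%R phi (dual_linear phi).

Lemma dual_eqP phi psi : phi = psi <-> phi =1 psi.
Proof. by split=> [->//|e]; exact/val_inj/funext. Qed.

Lemma dualDE phi psi v : (phi + psi) v = phi v + psi v.
Proof. by []. Qed.

Lemma dualZE a phi v : (a *: phi) v = a * phi v.
Proof. by []. Qed.

Definition dual_norm phi : R := sup [set `|phi v| | v in [set v | `|v| <= 1]].

Lemma dual_norm_has_sup phi :
  has_sup [set `|phi v| | v in [set v | `|v| <= 1]].
Proof.
split; first by exists `|phi 0|, 0 => //=; rewrite normr0.
have /asboolP[_ [M HM]] := dual_funP phi; exists `|M| => _ [v /= v1 <-].
rewrite (le_trans (HM v))// (le_trans (ler_wpM2r _ (ler_norm M)))//.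
by rewrite ler_piMr.
Qed.

Lemma dual_norm_ge0 phi : 0 <= dual_norm phi.
Proof.
rewrite (@le_trans _ _ `|phi 0|)//; apply: ub_le_sup.
  by case: (dual_norm_has_sup phi).
by exists 0 => //=; rewrite normr0.
Qed.

Lemma dual_normP phi v : `|phi v| <= dual_norm phi * `|v|.
Proof.
have [->|v0] := eqVneq v 0; first by rewrite linear0 !normr0 mulr0.
have nv : 0 < `|v| by rewrite normr_gt0.
rewrite -ler_pdivrMr//.
have -> : `|phi v| / `|v| = `|phi (`|v|^-1 *: v)|.
  by rewrite linearZ/= normrM normfV normr_id mulrC.
apply: ub_le_sup.
  by case: (dual_norm_has_sup phi).
by exists (`|v|^-1 *: v) => //=; rewrite normrZ normfV normr_id mulVf// gt_eqF.
Qed.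

Lemma dual_norm_le phi M :
  0 <= M -> (forall v, `|phi v| <= M * `|v|) -> dual_norm phi <= M.
Proof.
move=> M0 HM; apply: ge_sup; first by case: (dual_norm_has_sup phi).
by move=> _ [v /= v1 <-]; rewrite (le_trans (HM v))// ler_piMr.
Qed.

Let normD phi psi : dual_norm (phi + psi) <= dual_norm phi + dual_norm psi.
Proof.
apply: dual_norm_le => [|v]; first by rewrite addr_ge0// dual_norm_ge0.
by rewrite (le_trans (ler_normD _ _))// mulrDl lerD// dual_normP.
Qed.

Let normZ_le a phi : dual_norm (a *: phi) <= `|a| * dual_norm phi.
Proof.
apply: dual_norm_le => [|v]; first by rewrite mulr_ge0// dual_norm_ge0.
by rewrite normrM -mulrA ler_wpM2l// dual_normP.
Qed.

Let normZ a phi : dual_norm (a *: phi) = `|a| * dual_norm phi.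
Proof.
have [->|a0] := eqVneq a 0.
  rewrite scale0r normr0 mul0r; apply/eqP; rewrite eq_le dual_norm_ge0.
  by have := normZ_le 0 phi; rewrite scale0r normr0 mul0r => ->.
apply/eqP; rewrite eq_le normZ_le/=.
have := normZ_le a^-1 (a *: phi); rewrite scalerA mulVf// scale1r normfV.
by rewrite ler_pdivlMl// normr_gt0.
Qed.

Let norm0_eq0 phi : dual_norm phi = 0 -> phi = 0.
Proof.
move=> phi0; apply/dual_eqP => v; apply/eqP; rewrite -normr_le0.
by have := dual_normP phi v; rewrite phi0 mul0r.
Qed.

HB.instance Definition _ := Lmodule_isNormed.Build R dual normD normZ norm0_eq0.

Lemma dual_normE phi : `|phi| = sup [set `|phi v| | v in [set v | `|v| <= 1]].
Proof. by []. Qed.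

Lemma dual_continuous phi : continuous phi.
Proof.
apply: bounded_linear_continuous; apply/linear_boundedP.
near=> r => v; rewrite (le_trans (dual_normP phi v))//.
by apply: ler_wpM2r => //; near: r; apply: nbhs_pinfty_ge; rewrite num_real.
Unshelve. all: by end_near. Qed.

Section CommonKernel.
Variables (n : nat) (phi : 'I_n -> dual).

Definition common_kernel_set : set V := \bigcap_i (phi i @^-1` [set 0]).

Lemma common_kernel_subspace : is_subspace common_kernel_set.
Proof.
split=> [i _|a u v ku kv i _] /=; first by rewrite linear0.
by rewrite linearP/= (ku i)// (kv i)// scaler0 addr0.
Qed.

Lemma common_kernel_closed : closed common_kernel_set.
Proof.
apply: closed_bigI => i _; apply: closed_comp; last exact: closed_eq.
by move=> x _; exact: dual_continuous.
Qed.

Definition common_kernel : closed_subspace V :=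
  ClosedSubspace common_kernel_subspace common_kernel_closed.

End CommonKernel.

End Dual.

Definition span_family (R : realType) (V : normedModType R) n (f : 'I_n -> V) :
    closed_subspace V :=
  ClosedSubspace (lin_span_subspace (range f)) (@closed_lin_span_range _ _ _ f).

Definition closed_span (R : realType) (V : normedModType R) (A : set V) :
    closed_subspace V :=
  ClosedSubspace (closure_subspace (lin_span_subspace A)) (@closed_closure _ _).

Section Lip0.
Variables (R : realType) (X : normedModType R).

Definition lip0_pred : {pred X -> R} :=
  fun f => `[< lipschitz f /\ f 0 = 0 >].

Record lip0 := Lip0 { lip0_fun :> X -> R; lip0_funP : lip0_fun \in lip0_pred }.

HB.instance Definition _ := [isSub for lip0_fun].
HB.instance Definition _ := [Choice of lip0 by <:].

Lemma lipschitzP (f : X -> R) :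
  lipschitz f <-> exists M, forall x y, `|f x - f y| <= M * `|x - y|.
Proof.
split=> [/pinfty_ex_gt0[M _ HM]|[M HM]].
  by exists M => x y; exact: (HM (x, y)).
apply: (@klipschitzW _ _ _ M); first exact: (@globally_properfilter _ _ (0, 0)).
by move=> -[x y] _; exact: HM.
Qed.

Lemma lip0_submod_closed : submod_closed lip0_pred.
Proof.
split=> [|a f g].
  apply/asboolP; split=> //; apply/lipschitzP; exists 0 => x y.
  by rewrite subrr normr0 mul0r.
move=> /asboolP[/lipschitzP[M HM] f0] /asboolP[/lipschitzP[N HN] g0].
apply/asboolP; split; last by rewrite !fctE f0 g0 scaler0 addr0.
apply/lipschitzP; exists (`|a| * M + N) => x y.
rewrite !fctE opprD addrACA -scalerBr (le_trans (ler_normD _ _))//.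
by rewrite mulrDl lerD// normrZ -mulrA ler_wpM2l.
Qed.

HB.instance Definition _ :=
  GRing.isSubmodClosed.Build R (X -> R) lip0_pred lip0_submod_closed.
HB.instance Definition _ := [SubChoice_isSubLmodule of lip0 by <:].

Implicit Types (f g : lip0) (a M : R) (x y : X).

Lemma lip0_eqP f g : f = g <-> f =1 g.
Proof. by split=> [->//|e]; exact/val_inj/funext. Qed.

Lemma lip0_at0 f : f 0 = 0.
Proof. by have /asboolP[] := lip0_funP f. Qed.

Lemma lip0DE f g x : (f + g) x = f x + g x.
Proof. by []. Qed.

Lemma lip0ZE a f x : (a *: f) x = a * f x.
Proof. by []. Qed.

(* If X is the zero space the set is empty and its [sup] is 0. *)
Definition lip_norm f : R :=
  sup [set r | exists x y, x != y /\ r = `|f x - f y| / `|x - y|].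

Let slope f :=
  [set r | exists x y, x != y /\ r = `|f x - f y| / `|x - y|].

Let slope_ubound f : has_ubound (slope f).
Proof.
have /asboolP[/lipschitzP[M HM] _] := lip0_funP f.
exists M => _ [x [y [xy ->]]].
by rewrite ler_pdivrMr ?HM// normr_gt0 subr_eq0.
Qed.

Lemma lip_norm_ge0 f : 0 <= lip_norm f.
Proof.
have [S0|] := eqVneq (slope f) set0.
  by rewrite /lip_norm -/(slope f) S0 sup0.
move=> /set0P[r Sr]; apply: (@le_trans _ _ r).
  by case: Sr => x [y [_ ->]]; rewrite divr_ge0.
by apply: ub_le_sup => //; exact: slope_ubound.
Qed.

Lemma lip_normP f x y : `|f x - f y| <= lip_norm f * `|x - y|.
Proof.
have [->|xy] := eqVneq x y; first by rewrite !subrr !normr0 mulr0.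
rewrite -ler_pdivrMr ?normr_gt0 ?subr_eq0//.
by apply: ub_le_sup; [exact: slope_ubound|exists x, y].
Qed.

Lemma lip_norm_le f M : 0 <= M ->
  (forall x y, `|f x - f y| <= M * `|x - y|) -> lip_norm f <= M.
Proof.
move=> M0 HM; have [S0|] := eqVneq (slope f) set0.
  by rewrite /lip_norm -/(slope f) S0 sup0.
move=> /set0P S0; apply: ge_sup => // _ [x [y [xy ->]]].
by rewrite ler_pdivrMr ?HM// normr_gt0 subr_eq0.
Qed.

Let normD f g : lip_norm (f + g) <= lip_norm f + lip_norm g.
Proof.
apply: lip_norm_le => [|x y]; first by rewrite addr_ge0// lip_norm_ge0.
rewrite !lip0DE opprD addrACA (le_trans (ler_normD _ _))//.
by rewrite mulrDl lerD// lip_normP.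
Qed.

Let normZ_le a f : lip_norm (a *: f) <= `|a| * lip_norm f.
Proof.
apply: lip_norm_le => [|x y]; first by rewrite mulr_ge0// lip_norm_ge0.
by rewrite !lip0ZE -mulrBr normrM -mulrA ler_wpM2l// lip_normP.
Qed.

Let normZ a f : lip_norm (a *: f) = `|a| * lip_norm f.
Proof.
have [->|a0] := eqVneq a 0.
  rewrite scale0r normr0 mul0r; apply/eqP; rewrite eq_le lip_norm_ge0.
  by have := normZ_le 0 f; rewrite scale0r normr0 mul0r => ->.
apply/eqP; rewrite eq_le normZ_le/=.
have := normZ_le a^-1 (a *: f); rewrite scalerA mulVf// scale1r normfV.
by rewrite ler_pdivlMl// normr_gt0.
Qed.

Let norm0_eq0 f : lip_norm f = 0 -> f = 0.
Proof.
move=> f0; apply/lip0_eqP => x; apply/eqP; rewrite -normr_le0.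
by have := lip_normP f x 0; rewrite f0 mul0r lip0_at0 subr0.
Qed.

HB.instance Definition _ := Lmodule_isNormed.Build R lip0 normD normZ norm0_eq0.

Lemma lip0_normE f : `|f| =
  sup [set r | exists x y, x != y /\ r = `|f x - f y| / `|x - y|].
Proof. by []. Qed.

Lemma evaluation_subproof x : (fun f : lip0 => f x) \in @dual_pred R lip0.
Proof.
apply/asboolP; split=> //; exists `|x| => f.
by rewrite mulrC; have := lip_normP f x 0; rewrite lip0_at0 !subr0.
Qed.

Definition evaluation x : dual lip0 := Dual (evaluation_subproof x).

Definition lipschitz_free := csub_space (closed_span (range evaluation)).

HB.instance Definition _ := NormedModule.on lipschitz_free.

Lemma delta_subproof x :
  evaluation x \in csub_pred (closed_span (range evaluation)).
Proof.
by apply/csub_predE; apply: subset_closure; apply: sub_lin_span; exists x.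
Qed.

Definition delta x : lipschitz_free := CsubElem (delta_subproof x).

Lemma deltaE x f : csub_val (delta x) f = f x.
Proof. by []. Qed.

Lemma lip0_hat_ex f :
  exists fhat : dual lipschitz_free, forall x, fhat (delta x) = f x.
Proof.
have fhatP : (fun mu : lipschitz_free => csub_val mu f) \in
    @dual_pred R lipschitz_free.
  apply/asboolP; split=> //; exists `|f| => mu; rewrite mulrC.
  exact: dual_normP.
by exists (Dual fhatP).
Qed.

End Lip0.

(* Main.v *)
(* Send the class of g to the restriction of mu |-> mu(g) to the common kernel K
   of the hats of f_1, ..., f_n.  Functionals on F(X) are determined by their
   values on the deltas, and every one of them is the hat of a g with
   Lip(g) <= its norm; a functional vanishes on K iff it is a linear combination
   of the hats of the f_i, so the map is well defined and injective.
   Hahn-Banach, obtained by applying Zorn's lemma to graphs of dominated linear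
   functionals, extends a functional on K to F(X) with the same norm, which
   gives surjectivity and the lower bound on the norm at once. *)

From HB Require Import structures.
Require Import Defs.
From mathcomp Require Import all_boot all_order all_algebra.
From mathcomp Require Import all_classical all_reals all_analysis.
From mathcomp Require Import ring lra.

Set Implicit Arguments.
Unset Strict Implicit.
Unset Printing Implicit Defensive.

Import Order.TTheory GRing.Theory Num.Theory.
Import numFieldNormedType.Exports.

Local Open Scope classical_set_scope.
Local Open Scope ring_scope.
Local Open Scope quotient_scope.

(** * Hahn-Banach through dominated graphs *)

Section HahnBanach.
Variables (R : realType) (V : normedModType R) (M : R).
Hypothesis M_ge0 : 0 <= M.
Implicit Types (G H : set (V * R^o)) (u v : V) (r s c : R).

(* The graph of a linear functional bounded by [M] on its domain: domination
   at [v = 0] makes such a subspace single-valued. *)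
Definition dominated_graph G :=
  is_subspace G /\ forall v r, G (v, r) -> r <= M * `|v|.

Lemma dominated_graph_functional G v r s :
  dominated_graph G -> G (v, r) -> G (v, s) -> r = s.
Proof.
move=> [sG dG] Gr Gs; apply/eqP; rewrite eq_le -subr_le0 -[s <= r]subr_le0.
have sub p q : G (v, p) -> G (v, q) -> p - q <= 0.
  move=> Gp Gq; have := subspaceB sG Gp Gq.
  rewrite [X in G X](_ : _ = (v - v, p - q))// subrr => /dG.
  by rewrite normr0 mulr0.
by rewrite !sub.
Qed.

(** A value [c] at [v] must satisfy [r - M * |u - v| <= c <= M * |u + v| - r] for all [(u, r)] in
    [G]. By the triangle inequality every lower bound is below every upper bound, so the supremum of
    the lower bounds serves. If [v] is already in the domain, these bounds force [c] to be its value
    there. *)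
Lemma dominated_graph_extend G v : dominated_graph G ->
  exists H, [/\ dominated_graph H, G `<=` H & exists c, H (v, c)].
Proof.
move=> [sG dG].
have G0 : G (0, 0) by case: sG.
pose L := [set x | exists u r, G (u, r) /\ x = r - M * `|u - v|].
have Lub u r : G (u, r) -> ubound L (M * `|u + v| - r).
  move=> Gu _ [u' [r' [Gu' ->]]].
  have := subspaceD sG Gu Gu'; rewrite [X in G X](_ : _ = (u + u', r + r'))//.
  move=> /dG; have : M * `|u + u'| <= M * `|u + v| + M * `|u' - v|.
    rewrite -mulrDr ler_wpM2l//; have -> : u + u' = (u + v) + (u' - v).
      by rewrite addrACA subrr addr0.
    exact: ler_normD.
  lra.
have supL : has_sup L.
  split; first by exists (0 - M * `|0 - v|), 0, 0.
  by exists (M * `|0 + v| - 0); exact: Lub.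
pose c := sup L.
have cl u r : G (u, r) -> r - c <= M * `|u - v|.
  move=> Gu; have : r - M * `|u - v| <= c.
    by apply: ub_le_sup; [case: supL|exists u, r].
  lra.
have cu u r : G (u, r) -> r + c <= M * `|u + v|.
  by move=> /Lub/(ge_sup supL.1); rewrite -/c; lra.
exists [set p | exists s u r, G (u, r) /\ p = (u + s *: v, r + s * c)]; split.
- split; first split.
  + by exists 0, 0, 0; split => //; rewrite scale0r mul0r !addr0.
  + move=> a _ _ [s [u [r [Gu ->]]]] [s' [u' [r' [Gu' ->]]]].
    exists (a * s + s'), (a *: u + u'), (a * r + r'); split.
      by case: sG => _ /(_ a _ _ Gu Gu').
    congr (_, _); rewrite /=.
      by rewrite scalerDr scalerDl scalerA addrACA.
    by rewrite /GRing.scale/=; ring.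
  + move=> _ _ [s [u [r [Gu [-> ->]]]]].
    have Gs t : G (t *: u, t * r) by exact: (subspaceZ t sG Gu).
    (* Dividing by the absolute value of [s] reduces domination to [cu] for positive [s] and to [cl]
       for negative [s]. *)
    have [s0|s0|->] := ltgtP s 0; last first.
    * by rewrite scale0r mul0r !addr0; exact: dG.
    * have := cu _ _ (Gs s^-1).
      have -> : s^-1 *: u + v = s^-1 *: (u + s *: v).
        by rewrite scalerDr scalerA mulVf ?scale1r// gt_eqF.
      rewrite normrZ gtr0_norm ?invr_gt0// mulrCA ler_pdivlMl//.
      by rewrite mulrDr mulVKf// gt_eqF.
    * have t0 : 0 < - s by rewrite oppr_gt0.
      have := cl _ _ (Gs (- s)^-1).
      have -> : (- s)^-1 *: u - v = (- s)^-1 *: (u + s *: v).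
        by rewrite scalerDr scalerA invrN mulNr mulVf ?scaleN1r// lt_eqF.
      rewrite normrZ gtr0_norm ?invr_gt0// mulrCA ler_pdivlMl//.
      by rewrite mulrBr mulVKf ?gt_eqF// mulNr opprK.
- by move=> [u r] Gu; exists 0, u, r; rewrite scale0r mul0r !addr0.
- exists c, 1, 0, 0; split => //; by rewrite scale1r mul1r !add0r.
Qed.

(** Zorn's lemma also tests the empty chain, whose union is not a subspace; adjoining [G] to every
    set repairs this and keeps [G] inside the maximal graph. *)
Lemma dominated_graph_chain G (F : set (set (V * R^o))) :
  dominated_graph G -> (forall A, F A -> dominated_graph (A `|` G)) ->
  total_on F subset -> dominated_graph ((\bigcup_(A in F) A) `|` G).
Proof.
move=> dG dF totF; have FG A : F A -> A `|` G `<=` (\bigcup_(A in F) A) `|` G.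
  by move=> FA; apply: setSU => x Ax; exists A.
split; first split.
- by right; case: dG => -[].
- move=> a p q [[A FA Ap]|Gp] [[B FB Bq]|Gq].
  + have [AB|BA] := totF A B FA FB.
      have [[_ + _]] := dF B FB.
      by move=> /(_ a p q (or_introl (AB _ Ap)) (or_introl Bq))/(FG _ FB).
    have [[_ + _]] := dF A FA.
    by move=> /(_ a p q (or_introl Ap) (or_introl (BA _ Bq)))/(FG _ FA).
  + have [[_ + _]] := dF A FA.
    by move=> /(_ a p q (or_introl Ap) (or_intror Gq))/(FG _ FA).
  + have [[_ + _]] := dF B FB.
    by move=> /(_ a p q (or_intror Gp) (or_introl Bq))/(FG _ FB).
  + by right; case: dG => -[_ + _]; exact.
- move=> v r [[A FA Av]|Gv]; last by case: dG => _; exact.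
  by case: (dF A FA) => _; apply; left.
Qed.

Lemma dominated_graph_total G : dominated_graph G ->
  exists H, [/\ dominated_graph H, G `<=` H & forall v, exists r, H (v, r)].
Proof.
move=> dG.
have [|A [dA maxA]] := @Zorn_bigcup _ [set A | dominated_graph (A `|` G)].
  by move=> F dF; exact: dominated_graph_chain.
exists (A `|` G); split => // v; apply: contrapT => nv.
have [H [dH AH [c Hc]]] := dominated_graph_extend v dA.
(* [H] strictly contains [A], because [A] has no value at [v]. *)
apply: (maxA H); last first.
  by rewrite /= setUidl// => p Gp; apply: AH; right.
split=> [p Ap|HA]; first by apply: AH; left.
by apply: nv; exists c; left; exact: HA.
Qed.

End HahnBanach.

(** * Restriction, norm-preserving extension, and common kernels *)

Section Duals.
Variables (R : realType) (V : normedModType R).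

Section Restrict.
Variable W : closed_subspace V.

Lemma dual_restrict_subproof (psi : dual V) :
  (fun w : csub_space W => psi (csub_val w)) \in @dual_pred R (csub_space W).
Proof.
apply/asboolP; split=> [a u v|]; first exact: linearP.
by exists (dual_norm psi) => v; exact: dual_normP.
Qed.

Definition dual_restrict psi : dual (csub_space W) :=
  Dual (dual_restrict_subproof psi).

Lemma dual_restrict_norm psi : `|dual_restrict psi| <= `|psi|.
Proof.
by apply: dual_norm_le => [|v]; [exact: dual_norm_ge0|exact: (dual_normP psi)].
Qed.

Lemma hahn_banach (phi : dual (csub_space W)) :
  exists2 psi : dual V, dual_restrict psi = phi & `|psi| <= `|phi|.
Proof.
have phi0 : 0 <= `|phi| by [].
pose G : set (V * R^o) := [set p | exists w, p = (csub_val w, phi w)].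
have dG : dominated_graph `|phi| G.
  split; first split.
  - by exists 0; rewrite linear0.
  - by move=> a _ _ [u ->] [v ->]; exists (a *: u + v); rewrite linearP.
  - move=> _ _ [w [-> ->]]; apply: (le_trans (ler_norm _)).
    exact: (dual_normP phi).
have [H [dH GH totH]] := dominated_graph_total phi0 dG.
have [psi Hpsi] := choice totH.
have psi_le v : psi v <= `|phi| * `|v| by case: dH => _; exact.
have psi_lin : linear (psi : V -> R).
  move=> a u v; apply: (dominated_graph_functional dH (Hpsi _)).
  by case: dH => -[_ + _]; move=> /(_ a _ _ (Hpsi u) (Hpsi v)).
(* Domination is one-sided; applying it at [- v] bounds the absolute value. *)
have psiN v : psi (- v) = - psi v.
  have psi0 : psi 0 = 0.
    by have := psi_lin (-1) 0 0; rewrite scaleN1r oppr0 addr0 scaleN1r addNr.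
  by have := psi_lin (-1) v 0; rewrite !addr0 psi0 addr0 !scaleN1r.
have psi_bound v : `|psi v| <= `|phi| * `|v|.
  by rewrite ler_norml psi_le andbT lerNl -psiN -[`|v|]normrN psi_le.
have psiP : psi \in @dual_pred R V by apply/asboolP; split=> //; exists `|phi|.
exists (Dual psiP); last exact: dual_norm_le.
apply/dual_eqP => w; apply: (dominated_graph_functional dH (Hpsi _)).
by apply: GH; exists w.
Qed.

End Restrict.

(** Induction on [n]: subtract from [psi] a multiple of the first functional so that the difference
    vanishes on the common kernel of the others. If the first functional is zero on that kernel, the
    multiple 0 works. *)
Lemma common_kernel_combination n (phi : 'I_n -> dual V) (psi : dual V) :
  (forall v, common_kernel_set phi v -> psi v = 0) ->
  exists c : 'I_n -> R, psi = \sum_(i < n) c i *: phi i.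
Proof.
elim: n phi psi => [|n IH] phi psi psi0.
  exists (fun=> 0); rewrite big_ord0; apply/dual_eqP => v.
  by apply: psi0 => -[].
pose phi' i := phi (lift ord0 i).
have [a [c psiE]] : exists a c,
    psi - a *: phi ord0 = \sum_(i < n) c i *: phi' i.
  have [[u ku phiu]|nu] :=
      pselect (exists2 u, common_kernel_set phi' u & phi ord0 u != 0).
    exists (psi u / phi ord0 u); apply: IH => v kv.
    (* Correcting [v] along [u] moves it into the kernel of [phi ord0] without leaving the other
       kernels. *)
    pose b := phi ord0 v / phi ord0 u.
    suff /psi0 : common_kernel_set phi (v - b *: u).
      rewrite linearB linearZ/= => /subr0_eq psiv.
      change (psi v - psi u / phi ord0 u * phi ord0 v = 0).
      by rewrite psiv /GRing.scale/= /b; ring.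
    move=> i _ /=; have [j ->|->] := unliftP ord0 i.
      rewrite linearB linearZ/= [phi _ v](kv j)// [phi _ u](ku j)//.
      by rewrite scaler0 subr0.
    by rewrite linearB linearZ/= /b /GRing.scale/= divfK// subrr.
  exists 0; apply: IH => v kv; rewrite scale0r subr0; apply: psi0 => i _ /=.
  have [j ->|->] := unliftP ord0 i; first exact: kv.
  by apply: contrapT => /eqP pv; apply: nu; exists v.
exists (fun i => if unlift ord0 i is Some j then c j else a).
rewrite big_ord_recl unlift_none; apply/eqP; rewrite addrC -subr_eq psiE.
by apply/eqP/eq_bigr => i _; rewrite liftK.
Qed.

End Duals.

(** * The duality between Lip_0(X) and F(X) *)

Section LipschitzFree.
Variables (R : realType) (X : normedModType R).
Implicit Types (g : lip0 X) (psi : dual (lipschitz_free X)).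

Lemma lip0_hat_subproof g :
  (fun mu : lipschitz_free X => csub_val mu g) \in
    @dual_pred R (lipschitz_free X).
Proof.
apply/asboolP; split=> [a mu nu|].
  by rewrite -[LHS]/((a *: csub_val mu + csub_val nu) g) dualDE dualZE.
exists `|g| => mu; rewrite mulrC; exact: (dual_normP (csub_val mu)).
Qed.

Definition lip0_hat g : dual (lipschitz_free X) := Dual (lip0_hat_subproof g).

Lemma lip0_hatP a g h : lip0_hat (a *: g + h) = a *: lip0_hat g + lip0_hat h.
Proof. by apply/dual_eqP => mu /=; rewrite linearP. Qed.

Lemma lip0_hat_norm g : `|lip0_hat g| <= `|g|.
Proof.
apply: dual_norm_le => [|mu]; first exact: lip_norm_ge0.
by rewrite mulrC; exact: (dual_normP (csub_val mu)).
Qed.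

(** Agreement on the deltas passes to their span by linearity and to its closure by continuity. *)
Lemma lip0_hat_unique psi g :
  (forall x : X, psi (delta x) = g x) -> psi = lip0_hat g.
Proof.
move=> psi_delta.
(* The span is taken in the dual of Lip_0(X), so the agreement set is transported there. *)
pose S := [set w | exists2 mu : lipschitz_free X,
  csub_val mu = w & psi mu = lip0_hat g mu].
have sS : is_subspace S.
  split; first by exists 0; rewrite ?linear0.
  move=> a _ _ [u <- uE] [v <- vE]; exists (a *: u + v); first by [].
  by move: uE vE; rewrite !linearP /= => -> ->.
have spanS : lin_span (range (@evaluation R X)) `<=` S.
  by move=> w; apply; split=> // _ [x _ <-]; exists (delta x).
apply/eqP; rewrite -subr_eq0; apply/eqP/dual_eqP => mu; apply/eqP.
change ((psi - lip0_hat g) mu == 0); rewrite -normr_le0.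
set d := psi - _; apply/ler_addgt0Pr => e e0; rewrite add0r.
(* The added 1 keeps the divisor positive even when [d] is zero. *)
have d0 : 0 < `|d| + 1 by rewrite ltr_wpDl.
have /csub_predE/closure_normP/(_ _ (divr_gt0 e0 d0)) := csub_valP mu.
move=> [w /spanS[nu <- nuE] mu_nu].
have -> : d mu = d (mu - nu).
  rewrite linearB [X in _ - X](_ : _ = 0) ?subr0//.
  by change (psi nu - lip0_hat g nu = 0); rewrite nuE subrr.
rewrite (le_trans (dual_normP _ _))//.
rewrite (@le_trans _ _ ((`|d| + 1) * `|mu - nu|))//.
  by rewrite ler_wpM2r// lerDl.
by rewrite mulrC -ler_pdivlMr// ltW.
Qed.

Lemma delta_dist (x y : X) : `|delta x - delta y| <= `|x - y|.
Proof.
apply: (@dual_norm_le _ _ (evaluation x - evaluation y)) => // g; rewrite mulrC.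
exact: (lip_normP g x y).
Qed.

Lemma delta0 : delta (0 : X) = 0.
Proof. by apply/val_inj/dual_eqP => g /=; exact: lip0_at0. Qed.

(** Take [g] to be [psi] composed with [delta]; since [delta] is 1-Lipschitz, the norm of [psi] is a
    Lipschitz constant for [g]. *)
Lemma lip0_hat_surj psi : exists2 g, lip0_hat g = psi & `|g| <= `|psi|.
Proof.
have lip (x y : X) : `|psi (delta x) - psi (delta y)| <= `|psi| * `|x - y|.
  rewrite -linearB (le_trans (dual_normP _ _))//.
  by rewrite ler_wpM2l ?delta_dist ?dual_norm_ge0.
have gP : (fun x => psi (delta x)) \in @lip0_pred R X.
  apply/asboolP; split; last by rewrite delta0 linear0.
  by apply/lipschitzP; exists `|psi|.
by exists (Lip0 gP); [apply/esym/lip0_hat_unique|exact: lip_norm_le].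
Qed.

End LipschitzFree.

(** * The isometry from the quotient onto the dual of the kernel *)

Section QuotientDual.
Variables (R : realType) (X : normedModType R) (n : nat).
Variables (f : 'I_n -> lip0 X) (fhat : 'I_n -> dual (lipschitz_free X)).
Hypothesis fhat_delta : forall i x, fhat i (delta x) = f i x.

Let Q := quotient_space (span_family f).
Let K := common_kernel fhat.
Let T (q : Q) : dual (csub_space K) := dual_restrict K (lip0_hat (repr q)).

(** The [fhat i] are given only by their values on the deltas; uniqueness identifies them with the
    hats of the [f i]. *)
Let lip0_hat_combination (c : 'I_n -> R) :
  lip0_hat (\sum_(i < n) c i *: f i) = \sum_(i < n) c i *: fhat i.
Proof.
rewrite (big_morph (@lip0_hat R X) (id1 := 0) (op1 := +%R)); first last.
- by apply/dual_eqP => mu /=; rewrite linear0.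
- by move=> g h; rewrite -[g]scale1r lip0_hatP !scale1r.
apply: eq_bigr => i _; rewrite (lip0_hat_unique (fhat_delta i)).
by apply/dual_eqP => mu /=; rewrite linearZ.
Qed.

(** Left to right gives injectivity of [T]; right to left makes [T] independent of the
    representative picked by [repr]. *)
Let restrict_hat_eqP g h :
  dual_restrict K (lip0_hat g) = dual_restrict K (lip0_hat h) <->
  \pi_Q g = \pi_Q h.
Proof.
rewrite quotient_eqP /span_family/= lin_span_range/=; split.
  move=> /dual_eqP gh.
  have /common_kernel_combination[c cE] : forall mu,
      common_kernel_set fhat mu -> (lip0_hat (g - h)) mu = 0.
    move=> mu kmu; have muK : mu \in csub_pred K by apply/csub_predE.
    have /= := gh (CsubElem muK).
    change (csub_val mu g = csub_val mu h -> csub_val mu (g - h) = 0).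
    by rewrite linearB/= => ->; rewrite subrr.
  (* Evaluating the identity of functionals at [delta x] recovers the identity of functions at
     [x]. *)
  exists c; apply/lip0_eqP => x.
  rewrite -lip0_hat_combination in cE.
  exact: (congr1 (fun psi : dual _ => psi (delta x)) cE).
move=> [c ghE]; apply/dual_eqP => mu /=; apply/eqP.
rewrite -subr_eq0 -linearB ghE; apply/eqP.
change (lip0_hat (\sum_(i < n) c i *: f i) (csub_val mu) = 0).
rewrite lip0_hat_combination.
have /csub_predE kmu := csub_valP mu.
elim/big_rec: _ => // i psi _ psi0.
change (c i * fhat i (csub_val mu) + psi (csub_val mu) = 0).
by rewrite psi0 (kmu i)// mulr0 addr0.
Qed.

Let TE g : T (\pi_Q g) = dual_restrict K (lip0_hat g).
Proof. by apply/restrict_hat_eqP; rewrite reprK. Qed.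

Let T_linear : linear T.
Proof.
move=> a p q; rewrite -[p]reprK -[q]reprK -quotient_piZ -quotient_piD !TE.
by rewrite lip0_hatP; exact/dual_eqP.
Qed.

HB.instance Definition _ :=
  GRing.isLinear.Build R Q (dual (csub_space K)) *:%R T T_linear.

Let T_lift phi : exists2 g, T (\pi_Q g) = phi & `|g| <= `|phi|.
Proof.
have [psi <- psi_le] := hahn_banach phi.
have [g gE g_le] := lip0_hat_surj psi.
by exists g; [rewrite TE gE|exact: le_trans psi_le].
Qed.

Let T_inj : injective T.
Proof.
by move=> p q; rewrite -[p]reprK -[q]reprK !TE => /restrict_hat_eqP.
Qed.

Let T_norm q : `|T q| = `|q|.
Proof.
apply/eqP; rewrite eq_le; apply/andP; split.
  apply/ler_addgt0Pr => e e0; have [g <- /ltW] := quotient_norm_lt q e0.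
  apply: le_trans; rewrite TE (le_trans (dual_restrict_norm _ _))//.
  exact: lip0_hat_norm.
(* By injectivity the lift [g] of [T q] lies in the class [q], so its norm bounds that of [q]. *)
have [g /T_inj <- ] := T_lift (T q).
by apply: le_trans; exact: quotient_norm_le.
Qed.

Lemma quotient_span_isometric_dual_kernel :
  isometrically_isomorphic Q (dual (csub_space K)).
Proof.
exists T; split; first exact: T_norm.
have /choice[h hP] phi : exists q, T q = phi.
  by have [g gE _] := T_lift phi; exists (\pi_Q g).
by exists h => // q; apply: T_inj.
Qed.

End QuotientDual.

Theorem proposition2p1 (R : realType) (X : completeNormedModType R) (n : nat)
    (f : 'I_n -> lip0 X) (f_indep : linearly_independent f)
    (fhat : 'I_n -> dual (lipschitz_free X))
    (fhat_delta : forall (i : 'I_n) (x : X), fhat i (delta x) = f i x) :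
  isometrically_isomorphic (quotient_space (span_family f))
    (dual (csub_space (common_kernel fhat))).
Proof. exact: quotient_span_isometric_dual_kernel. Qed.
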